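(* Let $(X,\tau)$ be a topological space, $\mathbb{P}$ a forcing notion, $\alpha$ an ordinal, and $\kappa=p(X)$. Suppose that (1) player ONE does not have a winning strategy in the game $\mathsf{G}_1^{<\alpha}(\mathcal{O},\mathcal{O})$ on $(X,\tau)$, and (2) player TWO has a winning strategy in the game $\mathsf{CG}^{<\alpha}({<}\kappa)$ on $\mathbb{P}$. Then $$\Vdash_{\mathbb{P}}\text{``ONE does not have a winning strategy in }\mathsf{G}_1^{<\alpha}(\mathcal{O},\mathcal{O})\text{ on }(\check{X},\tau^{\mathbb{P}})\text{''}.$$
   Context: A forcing notion is a poset; $q\le p$ means $q$ is stronger than $p$. $\Vdash_{\mathbb{P}}\varphi$ means every condition of $\mathbb{P}$ forces $\varphi$. For a space $(X,\tau)$ and a forcing notion $\mathbb{P}$, $\tau^{\mathbb{P}}$ denotes a $\mathbb{P}$-name for the topology on $X$ generated by $\tau$ (as a base) in a generic extension by $\mathbb{P}$. The cardinal $p(X)$: for a topological space $X=(X,\tau)$, $$p(X)=\aleph_0+\min\bigl(\{|\mathcal{G}| : \mathcal{G}\subseteq\tau\text{ and }\bigcap\mathcal{G}\notin\tau\}\cup\{|\tau|^{+}\}\bigr).$$ The game $\mathsf{G}_1^{<\alpha}(\mathcal{O},\mathcal{O})$ on $(X,\tau)$, for an ordinal $\alpha$: it is played by ONE and TWO for $\alpha$ innings. In inning $\beta<\alpha$, ONE chooses an open cover $\mathcal{U}_\beta$ of $X$ and then TWO chooses $H_\beta\in\mathcal{U}_\beta$. TWO wins if there is $\gamma<\alpha$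 such that $\{H_\beta:\beta<\gamma\}$ covers $X$ (it is not enough that $\{H_\beta:\beta<\alpha\}$ covers $X$); otherwise ONE wins. The cut-and-choose game $\mathsf{CG}^{<\alpha}({<}\kappa)$ on a poset $\mathbb{P}$, for an ordinal $\alpha$ and a cardinal $\kappa$: it is played by ONE and TWO for $\alpha$ innings. In the beginning ONE chooses $p\in\mathbb{P}$. In each inning $\beta<\alpha$, ONE chooses a $\mathbb{P}$-name $\dot\eta_\beta$ for an ordinal, and then TWO chooses a set $C_\beta$ of ordinals with $|C_\beta|<\kappa$. TWO wins if for every $\gamma<\alpha$ there is $q_\gamma\in\mathbb{P}$ with $q_\gamma\le p$ and $q_\gamma\Vdash_{\mathbb{P}}$ ``$\forall\beta<\gamma\,(\dot\eta_\beta\in\check C_\beta)$'' (a single $q$ working for all $\beta<\alpha$ is not required); otherwise ONE wins. *)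

(* Defs.v *)
From HB Require Import structures.
From mathcomp Require Import all_boot all_order.
From mathcomp Require Import boolp classical_sets functions cardinality topology.

Set Implicit Arguments.
Unset Strict Implicit.
Unset Printing Implicit Defensive.

Local Open Scope classical_set_scope.
Local Open Scope card_scope.

(** * Sets of the ground model

    Well-founded trees up to bisimulation: with choice, this is a model of ZFC
    whose powersets are the full ones. *)

Inductive V : Type := Vset (A : Type) (f : A -> V).

Fixpoint Veq (x y : V) {struct x} : Prop :=
  let: Vset A f := x in let: Vset B g := y in
  (forall i, exists j, Veq (f i) (g j)) /\ (forall j, exists i, Veq (f i) (g j)).

Definition Vmem (x y : V) : Prop := let: Vset B g := y in exists j, Veq x (g j).

Definition Vtransitive (x : V) := forall y z, Vmem y x -> Vmem z y -> Vmem z x.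

(* A von Neumann ordinal is a transitive set of transitive sets: by
   well-foundedness, membership is then a strict well-order on it. *)
Definition Vordinal (x : V) :=
  Vtransitive x /\ forall y, Vmem y x -> Vtransitive y.

(* The von Neumann ordinals that represent the points of a well-order, and
   its order type. *)
Definition Vrank disp (A : orderType disp)
    (wf : well_founded (fun a b : A => (a < b)%O)) : A -> V :=
  Fix wf (fun=> V)
    (fun a rec => Vset (fun b : {b : A | (b < a)%O} => rec (sval b) (svalP b))).

Definition Votype disp (A : orderType disp)
    (wf : well_founded (fun a b : A => (a < b)%O)) : V := Vset (Vrank wf).

(** * The cardinal p(X)

    A cardinal is represented by any type of that cardinality. The alias keeps
    all these types, including the topology [set X], in one universe. *)

Definition cardinal := Type.

Definition card_lt T U (A : set T) (B : set U) := (A #<= B) && (A #!= B).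

(* |x| < |K|: the elements of [x = {g i : i in B}] correspond to the classes of
   the indices [i] modulo equality of the [g i]. *)
Definition Vcard_lt (x : V) (K : cardinal) : Prop :=
  let: Vset B g := x in
  card_lt (range (fun i : B => [set j | Veq (g i) (g j)])) [set: K].

Definition is_succ_card (T : cardinal) (A : set T) (K : cardinal) :=
  card_lt A [set: K] /\
  forall L : cardinal, card_lt A [set: L] -> [set: K] #<= [set: L].

Definition p_candidate (X : topologicalType) (K : cardinal) :=
  (exists G : set (set X),
     [/\ G `<=` open, ~ open (\bigcap_(U in G) U) & [set: K] #= G])
  \/ is_succ_card (@open X) K.

Definition is_p (X : topologicalType) (K : cardinal) :=
  exists M : cardinal,
    [/\ p_candidate X M,
        (forall L : cardinal, p_candidate X L -> [set: M] #<= [set: L]) &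
        [set: K] #= [set: nat + M]].

(** * Names and the forcing relation *)

Section Forcing.
Context {disp : Order.disp_t} {P : porderType disp}.

(* [Name x s] is the name {(x i, s i) : i in A}. *)
Inductive name := Name (A : Type) (x : A -> name) (s : A -> P).

(* A sentence of the forcing language is given by the set of conditions that
   force it. *)
Definition sentence := P -> Prop.

Definition forced (phi : sentence) := forall p, phi p.

Fixpoint feq (a b : name) {struct a} : sentence := fun p =>
  let: Name A x s := a in let: Name B y t := b in
  (forall i q, (q <= p)%O -> (q <= s i)%O ->
     exists j r, [/\ (r <= q)%O, (r <= t j)%O & feq (x i) (y j) r]) /\
  (forall j q, (q <= p)%O -> (q <= t j)%O ->
     exists i r, [/\ (r <= q)%O, (r <= s i)%O & feq (x i) (y j) r]).

Definition fmem (a b : name) : sentence := fun p =>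
  let: Name B y t := b in
  forall q, (q <= p)%O ->
    exists j r, [/\ (r <= q)%O, (r <= t j)%O & feq a (y j) r].

Definition fnot (phi : sentence) : sentence := fun p =>
  forall q, (q <= p)%O -> ~ phi q.
Definition fand (phi psi : sentence) : sentence := fun p => phi p /\ psi p.
Definition for_ (phi psi : sentence) : sentence := fun p =>
  forall q, (q <= p)%O -> exists2 r, (r <= q)%O & phi r \/ psi r.
Definition fimp (phi psi : sentence) : sentence := fun p =>
  forall q, (q <= p)%O -> phi q -> psi q.
Definition fiff (phi psi : sentence) : sentence :=
  fand (fimp phi psi) (fimp psi phi).
Definition fall (phi : name -> sentence) : sentence := fun p =>
  forall a, phi a p.
Definition fex (phi : name -> sentence) : sentence := fun p =>
  forall q, (q <= p)%O -> exists2 r, (r <= q)%O & exists a, phi a r.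

(* All conditions occur as second coordinates, since [P] need not have a
   largest element. *)
Fixpoint check (x : V) : name :=
  let: Vset A f := x in Name (fun ip : A * P => check (f ip.1)) snd.

End Forcing.

Arguments name {disp} P.
Arguments sentence {disp} P.

Declare Scope forcing_scope.
Delimit Scope forcing_scope with forcing.
Bind Scope forcing_scope with sentence.

Notation "a ≐ b" := (feq a b) (at level 70) : forcing_scope.
Notation "a ∈ b" := (fmem a b) (at level 70) : forcing_scope.
Notation "¬ phi" := (fnot phi) (at level 75, right associativity)
  : forcing_scope.
Notation "phi ∧ psi" := (fand phi psi) (at level 80, right associativity)
  : forcing_scope.
Notation "phi ∨ psi" := (for_ phi psi) (at level 85, right associativity)
  : forcing_scope.
Notation "phi ⇒ psi" := (fimp phi psi) (at level 90, right associativity)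
  : forcing_scope.
Notation "phi ⇔ psi" := (fiff phi psi) (at level 95, no associativity)
  : forcing_scope.
Notation "∀ x , phi" := (fall (fun x => phi%forcing))
  (at level 200, x name, right associativity) : forcing_scope.
Notation "∃ x , phi" := (fex (fun x => phi%forcing))
  (at level 200, x name, right associativity) : forcing_scope.
Notation "∀ x ∈ a , phi" := (fall (fun x => fimp (fmem x a) phi%forcing))
  (at level 200, x name, a at level 69, right associativity) : forcing_scope.
Notation "∃ x ∈ a , phi" := (fex (fun x => fand (fmem x a) phi%forcing))
  (at level 200, x name, a at level 69, right associativity) : forcing_scope.

(** * Set theory and the covering game in the forcing language *)

Section ForcingLanguage.
Context {disp : Order.disp_t} {P : porderType disp}.
Implicit Types a b c f s x y z : name P.
Local Open Scope forcing_scope.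

Definition f_subset a b : sentence P := ∀ x ∈ a, x ∈ b.

Definition f_transitive a : sentence P := ∀ x ∈ a, f_subset x a.

Definition f_ordinal a : sentence P :=
  f_transitive a ∧ ∀ x ∈ a, f_transitive x.

Definition f_is_upair z a b : sentence P :=
  ∀ x, (x ∈ z ⇔ x ≐ a ∨ x ≐ b).

(* z = (a, b) = {{a}, {a, b}} *)
Definition f_is_pair z a b : sentence P :=
  ∃ u, ∃ v, f_is_upair u a a ∧ f_is_upair v a b ∧ f_is_upair z u v.

Definition f_maps f a b : sentence P := ∃ z ∈ f, f_is_pair z a b.

(* f is a function from a to b *)
Definition f_function f a b : sentence P :=
  (∀ z ∈ f, ∃ x ∈ a, ∃ y ∈ b, f_is_pair z x y) ∧
  (∀ x ∈ a, ∃ y, f_maps f x y) ∧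
  (∀ x, ∀ y, ∀ z, (f_maps f x y ∧ f_maps f x z ⇒ y ≐ z)).

(* g is the restriction of f to a *)
Definition f_is_restriction g f a : sentence P :=
  ∀ z, (z ∈ g ⇔ z ∈ f ∧ ∃ x ∈ a, ∃ y, f_is_pair z x y).

(* T is the topology generated by the base B: its elements are the unions of
   subfamilies of B. *)
Definition f_generated_topology T B : sentence P :=
  ∀ U, (U ∈ T ⇔
    ∃ F, f_subset F B ∧ ∀ x, (x ∈ U ⇔ ∃ W ∈ F, x ∈ W)).

Definition f_open_cover X T U : sentence P :=
  f_subset U T ∧ ∀ x ∈ X, ∃ H ∈ U, x ∈ H.

(* s is a sequence, of length less than alpha, of members of T *)
Definition f_position T alpha s : sentence P :=
  ∃ beta ∈ alpha, f_function s beta T.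

(* S is a function that maps TWO's choices in the innings before beta, for
   beta < alpha, to an open cover. *)
Definition f_ONE_strategy X T alpha S : sentence P :=
  (∀ z ∈ S, ∃ s, ∃ U,
     f_is_pair z s U ∧ f_position T alpha s ∧ f_open_cover X T U) ∧
  (∀ s, (f_position T alpha s ⇒ ∃ U, f_maps S s U)) ∧
  (∀ s, ∀ U, ∀ W, (f_maps S s U ∧ f_maps S s W ⇒ U ≐ W)).

(* H is the sequence of TWO's choices in a run in which ONE follows S. *)
Definition f_run T alpha S H : sentence P :=
  f_function H alpha T ∧
  ∀ beta ∈ alpha, ∀ s, ∀ U, ∀ h,
    (f_is_restriction s H beta ∧ f_maps S s U ∧ f_maps H beta h ⇒ h ∈ U).

Definition f_TWO_wins_run X alpha H : sentence P :=
  ∃ gamma ∈ alpha, ∀ x ∈ X, ∃ beta ∈ gamma, ∃ h, f_maps H beta h ∧ x ∈ h.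

Definition f_ONE_has_winning_strategy_G1 X T alpha : sentence P :=
  ∃ S, f_ONE_strategy X T alpha S ∧
    ∀ H, (f_run T alpha S H ⇒ ¬ f_TWO_wins_run X alpha H).

End ForcingLanguage.

(** * The games in the ground model

    The ordinal alpha is a well-order [A]; its points are the ordinals below
    alpha. A strategy sees the opponent's moves only, since they determine the
    player's own ones. *)

Section GroundGames.
Context {dA : Order.disp_t} (A : orderType dA).

Definition open_cover (X : topologicalType) (U : set (set X)) :=
  U `<=` open /\ \bigcup_(H in U) H = setT.

Definition ONE_has_winning_strategy_G1 (X : topologicalType) :=
  exists S : forall b : A, ({c : A | (c < b)%O} -> set X) -> set (set X),
    (forall b h, (forall c, open (h c)) -> open_cover (S b h)) /\
    (forall H : A -> set X,
       (forall b, S b (fun c => H (sval c)) (H b)) ->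
       ~ exists c : A, \bigcup_(b in [set b | (b < c)%O]) H b = setT).

Definition ordinal_name {d} (P : porderType d) :=
  {eta : name P | forced (f_ordinal eta)}.

Definition CG_move (K : cardinal) (C : V) :=
  (forall x, Vmem x C -> Vordinal x) /\ Vcard_lt C K.

Definition TWO_has_winning_strategy_CG {d} (P : porderType d) (K : cardinal) :=
  exists S : P -> forall b : A, ({c : A | (c <= b)%O} -> ordinal_name P) -> V,
    (forall p b eta, CG_move K (S p b eta)) /\
    (forall (p : P) (eta : A -> ordinal_name P) (c : A),
       exists2 q : P, (q <= p)%O & forall b : A, (b < c)%O ->
         fmem (sval (eta b)) (check (S p b (fun b' => eta (sval b')))) q).

End GroundGames.

(** * The space in the ground model as a set

    [e] says which sets the points of the space are. *)

Definition Vspace (X : Type) (e : X -> V) : V := Vset e.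

Definition Vtopology (X : topologicalType) (e : X -> V) : V :=
  Vset (fun U : {U : set X | open U} =>
          Vset (fun x : {x : X | sval U x} => e (sval x))).

(** * Existence of a name for the generated topology *)

Import Order.Theory.
Local Open Scope order_scope.

Section GeneratedTopology.
Context {disp : Order.disp_t} {P : porderType disp}.
Implicit Types (a b c : name P) (p q r : P).
Lemma feq_mono a b p r : r <= p -> feq a b p -> feq a b r.
Proof.
case: a => A x s; case: b => B y t rp /= [h1 h2]; split=> i q qr; [apply: h1|apply: h2]; exact: le_trans rp.
Qed.
Lemma feq_dense a b p : (forall q, q <= p -> exists2 r, r <= q & feq a b r) -> feq a b p.
Proof.
case: a => A x s; case: b => B y t /= h; split=> i q qp qi;
 have [r rq [h1 h2]] := h _ qp.
- have [j [r' [? ? ?]]] := h1 i r (lexx _) (le_trans rq qi).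
  by exists j, r'; split=> //; apply: le_trans rq.
- have [j [r' [? ? ?]]] := h2 i r (lexx _) (le_trans rq qi).
  by exists j, r'; split=> //; apply: le_trans rq.
Qed.
Lemma feq_refl a p : feq a a p.
Proof. by elim: a p => A x IH s p /=; split=> i q qp qi; exists i, q; split. Qed.
Lemma feq_sym a b p : feq a b p -> feq b a p.
Proof.
elim: a b p => A x IH s [B y t] p /= [h1 h2]; split=> i q qp qi.
- have [j [r [? ? /IH ?]]] := h2 i q qp qi; by exists j, r.
- have [j [r [? ? /IH ?]]] := h1 i q qp qi; by exists j, r.
Qed.
Lemma feq_trans a b c p : feq a b p -> feq b c p -> feq a c p.
Proof.
elim: a b c p => A x IH s [B y t] [C z u] p /= [h1 h2] [k1 k2]; split=> i q qp qi.
- have [j [r [rq rj ij]]] := h1 i q qp qi.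
  have [l [r' [r'q r'j jl]]] := k1 j r (le_trans rq qp) rj.
  exists l, r'; split=> //; first exact: le_trans rq.
  exact: IH (feq_mono r'q ij) jl.
- have [j [r [rq rj ij]]] := k2 i q qp qi.
  have [l [r' [r'q r'j jl]]] := h2 j r (le_trans rq qp) rj.
  exists l, r'; split=> //; first exact: le_trans rq.
  exact: IH jl (feq_mono r'q ij).
Qed.
Lemma fmem_mono a b p r : r <= p -> fmem a b p -> fmem a b r.
Proof. case: b => B y t rp /= h q qr; apply: h; exact: le_trans rp. Qed.
Lemma fmem_dense a b p : (forall q, q <= p -> exists2 r, r <= q & fmem a b r) -> fmem a b p.
Proof.
case: b => B y t /= h q /h [r rq k]; have [j [r' [? ? ?]]] := k r (lexx _).
by exists j, r'; split=> //; apply: le_trans rq.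
Qed.
Lemma fmem_eql a b c p : feq a b p -> fmem a c p -> fmem b c p.
Proof.
case: c => B y t ab /= h q qp; have [j [r [? ? ?]]] := h q qp.
exists j, r; split=> //; apply: feq_trans (feq_sym (feq_mono _ ab)) _ => //; exact: le_trans qp.
Qed.
Lemma fmem_eqr a b c p : feq b c p -> fmem a b p -> fmem a c p.
Proof.
case: b c => B y t [C z u] /= [h1 h2] h q qp; have [j [r [rq rj e]]] := h q qp.
have [k [r' [r'r ? ?]]] := h1 j r (le_trans rq qp) rj.
exists k, r'; split=> //; first exact: le_trans rq.
exact: feq_trans (feq_mono _ e) _.
Qed.
Lemma mem_Name A (x : A -> name P) s i p : p <= s i -> fmem (x i) (Name x s) p.
Proof. move=> h q qp; exists i, q; split=> //; [exact: le_trans h|exact: feq_refl]. Qed.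

Definition subname (A : Type) (x : A -> name P) (Q : A -> P -> Prop) : name P :=
  Name (A := {ip : A * P | Q ip.1 ip.2}) (fun ip => x (sval ip).1) (fun ip => (sval ip).2).

Lemma in_subname A (x : A -> name P) Q i p : Q i p -> fmem (x i) (subname x Q) p.
Proof. by move=> h; apply: (@mem_Name _ _ _ (exist _ (i,p) h)). Qed.

Context {X : topologicalType} (e : X -> V).
Let O := {U : set X | open U}.
Definition uname (Q : O -> P -> Prop) : name P :=
  subname (fun x => check (e x)) (fun x p => exists2 U : O, sval U x & Q U p).
Definition top_name : name P := Name (fun Qp : (O -> P -> Prop) * P => uname Qp.1) snd.
Definition oname (U : O) : name P := check (Vset (fun x : {x : X | sval U x} => e (sval x))).

Lemma memU a Q p : (forall U p q, q <= p -> Q U p -> Q U q) ->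
  fmem a (uname Q) p <-> forall q, q <= p -> exists2 r, r <= q & exists U : O, Q U r /\ fmem a (oname U) r.
Proof.
move=> Qm; split=> h.
- move=> q qp; have [[[x p'] /= [U Ux QU]] [r [rq rp ax]]] := h q qp.
  exists r => //; exists U; split; first exact: Qm QU.
  by move=> q' q'r; exists (exist _ x Ux, r), q'; split=> //=; apply: feq_mono ax.
- move=> q qp; have [r rq [U [QU aU]]] := h q qp.
  have [[[x Ux] p'] /= [r' [r'r r'p ax]]] := aU r (lexx _).
  exists (exist _ (x, r) (ex_intro2 _ _ U Ux QU)), r'; split=> //; exact: le_trans rq.
Qed.

Lemma memF a Q p : (forall U p q, q <= p -> Q U p -> Q U q) ->
  fmem a (subname oname Q) p <-> forall q, q <= p -> exists2 r, r <= q & exists U : O, Q U r /\ feq a (oname U) r.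
Proof.
move=> Qm; split=> h.
- move=> q qp; have [[[x p'] /= QU] [r [rq rp ax]]] := h q qp.
  by exists r => //; exists x; split=> //; exact: Qm QU.
- move=> q qp; have [r rq [U [QU aU]]] := h q qp.
  by exists (exist _ (U, r) QU), r.
Qed.
Definition dn (Q : O -> P -> Prop) U p := exists2 q, p <= q & Q U q.

Lemma uname_dn Q p : feq (uname Q) (uname (dn Q)) p.
Proof.
split.
- move=> [[x r] [U Ux QU]] q qp /= qr.
  have h : dn Q U r by exists r.
  exists (exist _ (x, r) (ex_intro2 _ _ U Ux h)), q; split=> //; exact: feq_refl.
- move=> [[x r] [U Ux [r' rr' QU]]] q qp /= qr.
  exists (exist _ (x, r') (ex_intro2 _ _ U Ux QU)), q; split=> //=; [exact: le_trans rr'|exact: feq_refl].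
Qed.
Lemma dn_mono Q U p q : q <= p -> dn Q U p -> dn Q U q.
Proof. by move=> qp [r pr h]; exists r => //; exact: le_trans pr. Qed.

Lemma top_nameP : forced (f_generated_topology top_name (check (Vtopology e))).
Proof.
move=> p U; split=> q qp.
- move=> h q' q'q; have [[Q p'] /= [r [rq' rp' UQ]]] := h q' q'q.
  exists r => //; exists (subname oname (dn Q)); split.
  + move=> W r1 r1r /memF WF.
    apply: fmem_dense => r2 r2r1; have [r3 r32 [W' [_ WW']]] := WF (@dn_mono Q) r2 r2r1.
    exists r3 => //; apply: fmem_eql (feq_sym WW') _.
    by move=> r4 r43; exists (W', r4), r4; split=> //; apply: feq_refl.
  + move=> x; have UQ' := feq_trans UQ (uname_dn Q r); split=> r1 r1r.
    * move=> /(fmem_eqr (feq_mono r1r UQ'))/memU xU r2 r2r1.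
      have [r3 r32 [W [QW xW]]] := xU (@dn_mono Q) r2 r2r1.
      exists r3 => //; exists (oname W); split=> //.
      exact: in_subname.
    * move=> xx; apply: fmem_eqr (feq_sym (feq_mono r1r UQ')) _.
      apply/memU; first exact: dn_mono.
      move=> r2 r2r1; have [r3 r32 [W [/memF WF xW]]] := xx r2 r2r1.
      have [r4 r43 [W' [QW' WW']]] := WF (@dn_mono Q) r3 (lexx _).
      exists r4; first exact: le_trans r32.
      exists W'; split=> //; apply: fmem_eqr WW' _; exact: fmem_mono xW.
- move=> h; apply: fmem_dense => q' /h [r rq' [F [FB FU]]]; exists r => //.
  pose Q W r := fmem (oname W) F r.
  have Qm : (forall U p q, q <= p -> Q U p -> Q U q) by move=> *; apply: fmem_mono; eauto.
  have FQ x r1 : r1 <= r -> fmem x (uname Q) r1 <-> fmem x U r1.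
    move=> r1r; have [k1 k2] := FU x; split=> k.
    - apply: k2 => //; move/memU: k => /(_ Qm) k.
      move=> r2 /k [r3 r32 [W [QW xW]]]; exists r3 => //; by exists (oname W).
    - apply/memU => //; move=> r2 r2r1.
      have [r3 r32 [W [WF xW]]] := k1 _ r1r k r2 r2r1.
      have WB := FB W r3 (le_trans r32 (le_trans r2r1 r1r)) WF.
      have [[W' p3] [r4 [r43 _ WW']]] := WB r3 (lexx _).
      exists r4; first exact: le_trans r32.
      exists W'; split.
        apply: fmem_eql WW' _; exact: fmem_mono WF.
      apply: fmem_eqr WW' _; exact: fmem_mono xW.
  apply: (@fmem_eql (uname Q)).
    have ext a b p1 : (forall x r1, r1 <= p1 -> fmem x a r1 <-> fmem x b r1) -> feq a b p1.
      case: a b => A x s [B y t] hh; split=> i r1 r1p ri.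
      - have /hh hm : fmem (x i) (Name x s) r1 by apply: mem_Name.
        by have [j [r2 [? ? ?]]] := hm r1p r1 (lexx _); exists j, r2.
      - have /hh hm : fmem (y i) (Name y t) r1 by apply: mem_Name.
        by have [j [r2 [? ? /feq_sym ?]]] := hm r1p r1 (lexx _); exists j, r2.
    by apply: ext.
  by move=> r1 _; exists (Q, r1), r1; split=> //; exact: feq_refl.
Qed.
End GeneratedTopology.

(* Main.v *)
(** Let [p] force that [S] is a winning strategy for ONE in the extension. In the
    ground model, ONE plays in inning [b] the cover by the sets
    [B x] = the intersection of all open [W] containing [x] whose code lies in
    the set [C x] with which TWO, following a winning strategy in the
    cut-and-choose game, answers the name [eta x] of (the code of) an open set
    [W] such that [x] is in [W] and [W] is included in a member [H x] of the
    cover played by [S]. The sets [B x] are open because [C x] has fewer than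
    [p(X)] elements. When TWO picks [B x], the run of the cut-and-choose game is
    continued with [eta x], and the run against [S] with [H x]. If TWO wins a run
    of the game in the ground model, some [q <= p] forces each [eta x] to lie in
    [C x], hence [B x] to be included in [H x], up to the inning in which the
    [B x] cover [X]; so [q] forces TWO to win the run against [S]. *)

Require Import Defs.
From HB Require Import structures.
From mathcomp Require Import all_boot all_order.
From mathcomp Require Import boolp classical_sets functions cardinality topology.
From mathcomp Require Import wochoice.

Set Implicit Arguments.
Unset Strict Implicit.
Unset Printing Implicit Defensive.

Import Order.Theory.
Local Open Scope classical_set_scope.
Local Open Scope card_scope.
Local Open Scope order_scope.

(** * Well-orders as strict well-founded relations *)

(** The strict order is the failure of the converse of a reflexive well-order. It will order the
    conditions in the maximal principle and provide ordinal codes for open sets. *)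
Lemma wellfounded_total_order (T : Type) :
  exists R : T -> T -> Prop,
    [/\ well_founded R, (forall b a c, R a b -> R b c -> R a c) &
        forall a b, [\/ R a b, a = b | R b a]].
Proof.
have [R Rwo] := @well_ordering_principle {classic T}.
have min2 a b : exists z, unique (minimum_of R [pred c | (c == a) || (c == b)]) z.
  by apply: Rwo; exists a; rewrite inE eqxx.
have Rt a b : R a b \/ R b a.
  have [z [[zab zmin] _]] := min2 a b.
  have za := zmin a; have zb := zmin b; rewrite !inE !eqxx orbT in za zb.
  by move: zab; rewrite inE => /orP[]/eqP <-; [left; apply: zb|right; apply: za].
have tri a b : [\/ ~ R b a, a = b | ~ R a b].
  have [ab|] := pselect (R a b); last by constructor 3.
  have [ba|] := pselect (R b a); last by constructor 1.
  constructor 2; have [z [_ zu]] := min2 a b.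
  have Rr c : R c c by case: (Rt c c).
  by rewrite -(zu a) ?(zu b)//; split; rewrite ?inE ?eqxx ?orbT// => c;
    rewrite inE => /orP[]/eqP->.
have wf : well_founded (fun a b : T => ~ R b a).
  move=> a; apply: contrapT => Na.
  have [|z [[/asboolP zA zmin] _]] :=
      Rwo [pred c : {classic T} | `[< ~ Acc (fun a b : T => ~ R b a) c >]].
    by exists a; apply/asboolP.
  apply: zA; constructor => y yz; apply: contrapT => Ny; apply: yz.
  by apply: zmin; apply/asboolP.
exists (fun a b : T => ~ R b a); split=> //.
(* A well-founded relation has no cycles of length two or three; with trichotomy this gives
   transitivity. *)
have no2 a b : ~ R b a -> ~ ~ R a b.
  by elim/(well_founded_ind wf): a b => a IH b ab ba; exact: (IH b ba a).
have no3 a b c : ~ R b a -> ~ R c b -> ~ ~ R a c.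
  elim/(well_founded_ind wf): a b c => a IH b c ab bc ca.
  exact: (IH c ca a b).
move=> b a c ab bc; case: (tri a c) => // [ac|/(no3 _ _ _ ab bc)//].
by case: (no2 _ _ ab); rewrite ac.
Qed.

(** * Sets up to bisimulation and von Neumann ranks *)

Lemma Veq_refl x : Veq x x.
Proof. by elim: x => A f IH /=; split=> i; exists i. Qed.

Lemma Veq_sym x y : Veq x y -> Veq y x.
Proof.
elim: x y => A f IH [B g] /= [h1 h2]; split=> i.
- by have [j /IH] := h2 i; exists j.
- by have [j /IH] := h1 i; exists j.
Qed.

Lemma Veq_trans x y z : Veq x y -> Veq y z -> Veq x z.
Proof.
elim: x y z => A f IH [B g] [C h] /= [h1 h2] [k1 k2]; split=> i.
- by have [j ij] := h1 i; have [k jk] := k1 j; exists k; apply: IH jk.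
- by have [j ij] := k2 i; have [k jk] := h2 j; exists k; apply: IH ij.
Qed.

Lemma Vmem_eqr x y z : Veq y z -> Vmem x y -> Vmem x z.
Proof.
case: y z => B g [C h] [yz _] [j xj]; have [k jk] := yz j.
by exists k; apply: Veq_trans jk.
Qed.

Lemma Vmem_irrefl x : ~ Vmem x x.
Proof.
elim: x => A f IH [i xi]; apply: (IH i).
by apply: Vmem_eqr xi _; exists i; apply: Veq_refl.
Qed.

Section Ranks.
Context (T : Type) (R : T -> T -> Prop) (g : T -> V).
Hypothesis gE : forall a, g a = Vset (fun b : {b | R b a} => g (sval b)).

Lemma Vmem_rank a y : Vmem y (g a) <-> exists2 b, R b a & Veq y (g b).
Proof.
rewrite gE; split; first by move=> [[b ba] yb]; exists b.
by move=> [b ba yb]; exists (exist _ b ba).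
Qed.

(** Two distinct points are comparable, so equal ranks would yield a set that is a member of
    itself. *)
Lemma rank_inj : (forall a b, [\/ R a b, a = b | R b a]) ->
  forall a b, Veq (g a) (g b) -> a = b.
Proof.
have lt a b : R a b -> ~ Veq (g a) (g b).
  move=> ab eab; apply: (@Vmem_irrefl (g a)); apply: Vmem_eqr (Veq_sym eab) _.
  by apply/Vmem_rank; exists a => //; apply: Veq_refl.
by move=> Rt a b ab; case: (Rt a b) => // /lt; case=> //; apply: Veq_sym.
Qed.

Lemma rank_ordinal : (forall b a c, R a b -> R b c -> R a c) ->
  forall a, Vordinal (g a).
Proof.
move=> Rtr.
have tr a : Vtransitive (g a).
  move=> y z /Vmem_rank[b ba yb] /(Vmem_eqr yb)/Vmem_rank[c cb zc].
  apply/Vmem_rank; exists c => //; exact: Rtr ba.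
move=> a; split=> // y /Vmem_rank[b ba yb] z w zy wz.
apply: Vmem_eqr (Veq_sym yb) _; apply: tr wz; exact: Vmem_eqr zy.
Qed.

End Ranks.

(** * Cardinal arithmetic and intersections of fewer than p(X) open sets *)

(* Hilbert's hotel. *)
Lemma card_le_nat_sum (T : Type) (U : pointedType) (A : set U) :
  infinite_set A -> [set: T] #<= A -> [set: nat + T] #<= A.
Proof.
move=> /infiniteP/pcard_leP/injfunPex[f fA finj] /pcard_leP/injfunPex[g gA ginj].
have {}finj m n : f m = f n -> m = n by apply: finj; rewrite inE.
have {}ginj m n : g m = g n -> m = n by apply: ginj; rewrite inE.
(* The guests [f n] move to odd rooms [f n.*2.+1] and all others stay, which frees the even rooms
   for [nat]. *)
have /choice[k kP] : forall t, exists u,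
    (exists2 n, g t = f n & u = f n.*2.+1) \/ (u = g t /\ forall n, g t <> f n).
  move=> t.
  have [[n gf]|ngf] := pselect (exists n, g t = f n).
    by exists (f n.*2.+1); left; exists n.
  by exists (g t); right; split=> // n gf; apply: ngf; exists n.
apply/pcard_leP/injfunPex.
exists (fun z => match z with inl n => f n.*2 | inr t => k t end).
  move=> [n|t] _ /=; first exact: fA.
  by case: (kP t) => [[n _ ->]|[-> _]]; [exact: fA|exact: gA].
have fk n t : f n.*2 <> k t.
  case: (kP t) => [[m _ ->]/finj/(congr1 odd)|[-> ngf] /esym/ngf//].
  by rewrite /= !odd_double.
move=> [m|s] [n|t] _ _ /=.
- by move=> /finj/double_inj->.
- by move/fk.
- by move/esym/fk.
- case: (kP s) => [[m sm ->]|[-> sm]]; case: (kP t) => [[n tn ->]|[-> tn]].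
  + by move=> /finj[/double_inj mn]; congr inr; apply: ginj; rewrite sm mn.
  + by move/esym/tn.
  + by move/sm.
  + by move/ginj->.
Qed.

Lemma finite_bigcap_open (X : topologicalType) (G : set (set X)) :
  finite_set G -> G `<=` open -> open (\bigcap_(U in G) U).
Proof.
move=> /finite_seqP[s ->]; rewrite bigcap_seq; elim: s => [|U s IH] sO.
  by rewrite big_nil; apply: openT.
rewrite big_cons; apply: openI; first by apply: sO; rewrite /= mem_head.
by apply: IH => W Ws; apply: sO; rewrite /= inE Ws orbT.
Qed.

(** A family of open sets with non-open intersection is a candidate in the definition of p(X). It is
    also infinite, so its size bounds the minimum even after [nat] is added. *)
Lemma bigcap_open_lt_p (X : topologicalType) (K : cardinal) (G : set (set X)) :
  is_p X K -> G `<=` open -> ~ ([set: K] #<= G) -> open (\bigcap_(U in G) U).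
Proof.
move=> [M [_ Mmin KM]] GO; apply: contra_notP => GNO.
rewrite (card_le_eql KM); apply: card_le_nat_sum.
  by move=> /finite_bigcap_open-/(_ GO).
have /Mmin : p_candidate X (set_type G).
  by left; exists G; split=> //; exact: card_setT.
by rewrite (card_le_eqr (card_setT G)).
Qed.

(** Coding embeds [G] in the bisimulation classes of the members of [C], so [G] is too small to
    contain a copy of [K]. *)
Lemma small_family_bigcap_open (X : topologicalType) (K : cardinal)
    (G : set (set X)) (code : set X -> V) (C : V) :
  is_p X K -> Vcard_lt C K -> G `<=` open ->
  (forall U W, G U -> G W -> Veq (code U) (code W) -> U = W) ->
  (forall U, G U -> Vmem (code U) C) ->
  open (\bigcap_(U in G) U).
Proof.
move=> K_p; case: C => B g /andP[CK nCK] GO code_inj GC.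
apply: bigcap_open_lt_p K_p GO _ => KG; move/negP: nCK; apply.
rewrite card_eq_le CK /=; apply: card_le_trans KG _.
apply/pcard_leP/injfunPex; exists (fun U => [set j | Veq (code U) (g j)]).
  move=> U /GC[i Ui]; exists i => //; apply/seteqP; split=> j.
    exact: Veq_trans Ui.
  exact: Veq_trans (Veq_sym Ui).
move=> U W; rewrite !inE => GU GW UW; apply: code_inj => //.
have [i Ui] := GC _ GU; apply: Veq_trans (Ui) _; apply: Veq_sym.
by have : [set j | Veq (code U) (g j)] i := Ui; rewrite UW.
Qed.

(** * Regular sentences, families of names and check names *)

Section Forcing.
Context {disp : Order.disp_t} {P : porderType disp}.
Implicit Types (a b c x y z : name P) (p q r : P) (phi psi chi : sentence P).

(* The sets of conditions that are regular open for the topology of the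
   downward closed sets: those that a sentence can have as its forcing set. *)
Class regular phi : Prop := Regular {
  forces_mono : forall p r, r <= p -> phi p -> phi r;
  forces_dense : forall p,
    (forall q, q <= p -> exists2 r, r <= q & phi r) -> phi p }.

#[export] Instance regular_feq a b : regular (feq a b).
Proof. by split=> *; [apply: feq_mono; eassumption|apply: feq_dense]. Qed.

#[export] Instance regular_fmem a b : regular (fmem a b).
Proof. by split=> *; [apply: fmem_mono; eassumption|apply: fmem_dense]. Qed.

#[export] Instance regular_fand phi psi :
  regular phi -> regular psi -> regular (fand phi psi).
Proof.
move=> R1 R2; split=> [p r rp [h1 h2]|p h].
  by split; [apply: forces_mono h1|apply: forces_mono h2].
by split; apply: forces_dense => q /h[r rq [h1 h2]]; exists r.
Qed.

#[export] Instance regular_fimp phi psi :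
  regular phi -> regular psi -> regular (fimp phi psi).
Proof.
move=> R1 R2; split=> [p r rp h q qr|p h q qp hq]; first exact/h/(le_trans qr).
apply: forces_dense => r rq; have [s sr hs] := h r (le_trans rq qp).
by exists s => //; apply: hs => //; apply: forces_mono hq; apply: le_trans rq.
Qed.

#[export] Instance regular_fall (phi : name P -> sentence P) :
  (forall a, regular (phi a)) -> regular (fall phi).
Proof.
move=> R; split=> [p r rp h a|p h a]; first exact: forces_mono (h a).
by apply: forces_dense => q /h[r rq hr]; exists r.
Qed.

#[export] Instance regular_fex (phi : name P -> sentence P) : regular (fex phi).
Proof.
split=> [p r rp h q qr|p h q /h[r rq /(_ r (lexx _))[s sr hs]]].
  exact/h/(le_trans qr).
by exists s => //; apply: le_trans rq.
Qed.

(** Witnesses exist only densely below [p]; a regular conclusion obtained there already holds at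
    [p]. *)
Lemma fex_elim (phi : name P -> sentence P) psi p : regular psi ->
  fex phi p -> (forall r a, r <= p -> phi a r -> psi r) -> psi p.
Proof.
move=> R h k; apply: forces_dense => q qp; have [r rq [a hr]] := h q qp.
by exists r => //; apply: k hr; apply: le_trans qp.
Qed.

Lemma for_elim phi psi chi p : regular chi -> for_ phi psi p ->
  (forall r, r <= p -> phi r -> chi r) ->
  (forall r, r <= p -> psi r -> chi r) -> chi p.
Proof.
move=> R h k1 k2; apply: forces_dense => q qp; have [r rq hr] := h q qp.
by exists r => //; case: hr => [/k1|/k2]; apply; exact: le_trans qp.
Qed.

Lemma fex_intro (phi : name P -> sentence P) a p :
  (forall q, q <= p -> phi a q) -> fex phi p.
Proof. by move=> h q qp; exists q => //; exists a; apply: h. Qed.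

Lemma feq_ext a b p :
  feq a b p <-> forall x r, r <= p -> fmem x a r <-> fmem x b r.
Proof.
split=> [ab x r rp|h].
  have ab' := feq_mono rp ab.
  by split; apply: fmem_eqr => //; apply: feq_sym.
case: a b h => A x s [B y t] h; split=> i r rp ri.
- have /h hm : fmem (x i) (Name x s) r by apply: mem_Name.
  by have [j [r' [? ? ?]]] := hm rp r (lexx _); exists j, r'.
- have /h hm : fmem (y i) (Name y t) r by apply: mem_Name.
  by have [j [r' [? ? /feq_sym ?]]] := hm rp r (lexx _); exists j, r'.
Qed.

Definition fam (I : Type) (x : I -> name P) : name P :=
  Name (A := I * P) (fun ip => x ip.1) snd.

Lemma fam_in (I : Type) (x : I -> name P) i p : fmem (x i) (fam x) p.
Proof. exact: (@mem_Name _ _ _ _ _ (i, p)). Qed.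
Arguments fam_in {I} x i {p}.

Lemma mem_fam (I : Type) (x : I -> name P) a p : fmem a (fam x) p <->
  forall q, q <= p -> exists2 r, r <= q & exists i, feq a (x i) r.
Proof.
split=> h q /h; first by move=> [[i s] [r [rq _ e]]]; exists r => //; exists i.
by move=> [r rq [i e]]; exists (i, r), r.
Qed.

Lemma fam_elim (I : Type) (x : I -> name P) a psi p : regular psi ->
  fmem a (fam x) p -> (forall r i, r <= p -> feq a (x i) r -> psi r) -> psi p.
Proof.
move=> R /mem_fam h k; apply: forces_dense => q qp; have [r rq [i e]] := h q qp.
by exists r => //; apply: k e; apply: le_trans qp.
Qed.

(** A single condition decides equality in the ground model: every condition occurs as a second
    coordinate, so the index [(i, p)] is available at [p]. *)
Lemma check_eq (x y : V) p : feq (check x) (check y) p -> Veq x y.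
Proof.
elim: x y p => A f IH [B g] p [h1 h2]; split=> i.
- have [[j s] [r [_ _ /IH]]] := h1 (i, p) p (lexx _) (lexx _).
  by exists j.
- have [[j s] [r [_ _ /IH]]] := h2 (i, p) p (lexx _) (lexx _).
  by exists j.
Qed.

Lemma eq_check (x y : V) p : Veq x y -> feq (check x) (check y) p.
Proof.
elim: x y p => A f IH [B g] p [h1 h2]; split=> -[i s] q qp qs.
- by have [j /IH e] := h1 i; exists (j, q), q; split.
- by have [j /IH e] := h2 i; exists (j, q), q; split.
Qed.

Lemma check_mem (x y : V) p : fmem (check x) (check y) p -> Vmem x y.
Proof.
by case: y => B g /(_ p (lexx _))[[j s] [r [_ _ /check_eq]]]; exists j.
Qed.

Lemma mem_check (x y : V) p : Vmem x y -> fmem (check x) (check y) p.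
Proof.
case: y => B g [j /Veq_sym/eq_check xj].
exact: fmem_eql (xj p) (fam_in (fun j => check (g j)) j).
Qed.

(** * Unordered and ordered pairs *)

Definition upair a b : name P := fam (fun c : bool => if c then a else b).

Lemma mem_upair x a b p :
  fmem x (upair a b) p <-> for_ (feq x a) (feq x b) p.
Proof.
split=> [/mem_fam h q /h[r rq [[|] e]]|h].
- by exists r => //; left.
- by exists r => //; right.
- apply/mem_fam => q /h[r rq [e|e]]; exists r => //; by [exists true|exists false].
Qed.

Lemma is_upairP z a b p : f_is_upair z a b p <-> feq z (upair a b) p.
Proof.
rewrite feq_ext; split=> h x.
  by move=> r rp; have [h1 h2] := h x; rewrite mem_upair; split;
    [apply: h1|apply: h2].
by split=> r rp; rewrite -mem_upair => ?; apply/h.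
Qed.

Lemma upair_cong a b a' b' p :
  feq a a' p -> feq b b' p -> feq (upair a b) (upair a' b') p.
Proof.
by move=> ha hb; split=> -[c s] q qp qs; exists (c, q), q; split=> //=;
  case: (c); apply: feq_mono qp _.
Qed.

Definition pair_name a b : name P := upair (upair a a) (upair a b).

Lemma pair_cong a b a' b' p :
  feq a a' p -> feq b b' p -> feq (pair_name a b) (pair_name a' b') p.
Proof. by move=> ha hb; do 2 apply: upair_cong => //. Qed.

Lemma upair_inr a b p : fmem b (upair a b) p.
Proof. exact: (fam_in _ false). Qed.
Arguments upair_inr a b {p}.

Lemma upair_inl a b p : fmem a (upair a b) p.
Proof. exact: (fam_in _ true). Qed.
Arguments upair_inl a b {p}.

Lemma mem_singleton x a p : fmem x (upair a a) p -> feq x a p.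
Proof. by move=> /mem_upair h; apply: (for_elim _ h). Qed.

Lemma pair_inj a b c d p : feq (pair_name a b) (pair_name c d) p ->
  feq a c p /\ feq b d p.
Proof.
move=> e.
have ac : feq a c p.
  have : fmem (upair a a) (pair_name c d) p by apply: fmem_eqr e (upair_inl _ _).
  move=> /mem_upair h; apply: (for_elim _ h) => {h} r rp aac;
    by apply: feq_sym; apply: mem_singleton;
       apply: fmem_eqr (feq_sym aac) (upair_inl _ _).
have bcd : fmem (upair a b) (pair_name c d) p by apply: fmem_eqr e (upair_inr _ _).
have dab : fmem (upair c d) (pair_name a b) p.
  by apply: fmem_eqr (feq_sym e) (upair_inr _ _).
split=> //.
have bcd' : fmem b (upair c d) p.
  move/mem_upair: bcd => h; apply: (for_elim _ h) => {h} r rp abc.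
    apply: (@fmem_eql _ _ c); last exact: upair_inl.
    by apply: feq_sym; apply: mem_singleton; apply: fmem_eqr abc (upair_inr _ _).
  exact: fmem_eqr abc (upair_inr _ _).
have dab' : fmem d (upair a b) p.
  move/mem_upair: dab => h; apply: (for_elim _ h) => {h} r rp cda.
    apply: (@fmem_eql _ _ a); last exact: upair_inl.
    by apply: feq_sym; apply: mem_singleton; apply: fmem_eqr cda (upair_inr _ _).
  exact: fmem_eqr cda (upair_inr _ _).
(* The only case left has [b] equal to [c] and [d] equal to [a]; then [ac] makes all four equal. *)
move/mem_upair: bcd' => h; apply: (for_elim _ h) => // {h} r rp bc.
move/mem_upair: (fmem_mono rp dab') => h.
apply: (for_elim _ h) => {h} s sr ds; last exact: feq_sym.
have ac' := feq_mono (le_trans sr rp) ac.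
exact: feq_trans (feq_trans (feq_mono sr bc) (feq_sym ac')) (feq_sym ds).
Qed.

Lemma is_pairP z a b p : f_is_pair z a b p <-> feq z (pair_name a b) p.
Proof.
split=> h.
  apply: (fex_elim _ h) => r u rp h'; apply: (fex_elim _ h') => {h'} s v sr.
  move=> [/is_upairP ua [/is_upairP vb /is_upairP zuv]].
  by apply: feq_trans zuv _; apply: upair_cong.
apply: (@fex_intro _ (upair a a)) => q qp.
apply: (@fex_intro _ (upair a b)) => r rq.
split; first by apply/is_upairP; apply: feq_refl.
split; first by apply/is_upairP; apply: feq_refl.
by apply/is_upairP; apply: feq_mono h; apply: le_trans qp.
Qed.

Lemma mapsP f a b p : f_maps f a b p <-> fmem (pair_name a b) f p.
Proof.
split=> h.
  apply: (fex_elim _ h) => r z rp [zf /is_pairP e]; exact: fmem_eql e zf.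
apply: (@fex_intro _ (pair_name a b)) => q qp; split; first exact: fmem_mono h.
by apply/is_pairP; apply: feq_refl.
Qed.


(** * The maximal principle *)

Definition idx a : Type := let: Name A _ _ := a in A.
Definition elt a : idx a -> name P := let: Name _ x _ := a in x.
Definition cond a : idx a -> P := let: Name _ _ s := a in s.

Lemma mem_nameE a x p : fmem x a p <-> forall q, q <= p ->
  exists (k : idx a) r, [/\ r <= q, r <= cond k & feq x (elt k) r].
Proof. by case: a. Qed.

(* The maximal principle. The witness mixes witnesses [f i] chosen at the
   conditions [i], each used below the conditions that exclude all smaller
   indices for a well-order of [P]; this replaces a maximal antichain. *)
Lemma fex_witness (phi : name P -> sentence P) :
  (forall a, regular (phi a)) ->
  (forall a b p, feq a b p -> phi a p -> phi b p) ->
  exists a, forall p, fex phi p -> phi a p.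
Proof.
move=> phiR phi_eq.
have /choice[f fP] : forall p, exists a, (exists b, phi b p) -> phi a p.
  move=> p; have [[b hb]|nb] := pselect (exists b, phi b p); first by exists b.
  by exists (check (Vset (fun e : False => match e with end))).
have [lt [lt_wf _ lt_total]] := wellfounded_total_order P.
pose Q i r := phi (f i) r /\
  forall j, lt j i -> forall s, s <= r -> ~ phi (f j) s.
pose J := {j : {i : P & idx (f i)} * P |
  j.2 <= cond (projT2 j.1) /\ Q (projT1 j.1) j.2}.
pose m : name P :=
  Name (A := J) (fun j => elt (projT2 (sval j).1)) (fun j => (sval j).2).
have Qmono i r s : s <= r -> Q i r -> Q i s.
  move=> sr [h1 h2]; split=> [|j ji t ts]; first exact: forces_mono h1.
  exact/(h2 _ ji)/(le_trans ts).
(* The smaller of two indices active at [r] would violate the exclusion clause of the larger. Hence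
   below a condition with [Q i] only elements of [f i] contribute to [m]. *)
have Qinj i j r : Q i r -> Q j r -> i = j.
  move=> [hi ni] [hj nj]; case: (lt_total i j) => // /[dup] ij.
    by case/nj/(_ r (lexx _)).
  by case/ni/(_ r (lexx _)).
have mE i r : Q i r -> feq m (f i) r.
  move=> Qi; apply/feq_ext => x s sr; rewrite 2!mem_nameE; split=> h q qs.
    have [[[[j k] t] /= [tk Qj]] /= [u [uq ut e]]] := h q qs.
    have ? : j = i.
      apply: (Qinj _ _ u); first exact: Qmono ut Qj.
      apply: Qmono Qi; apply: le_trans uq _; exact: le_trans qs sr.
    by subst j; exists k, u; split=> //; apply: le_trans tk.
  have [k [u [uq uk e]]] := h q qs.
  have Qu : Q i u.
    by apply: Qmono Qi; apply: le_trans uq _; apply: le_trans sr.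
  pose j : J := exist _ (existT (fun i => idx (f i)) i k, u) (conj uk Qu).
  by exists j, u.
exists m => p h; apply: forces_dense => q /h[r rq /fP hr].
(* The index [r] has its witness forced at [r] itself, so there is a least index whose witness is
   forced somewhere below [r]. *)
have [i [s sr hi] imin] : exists2 i, (exists2 s, s <= r & phi (f i) s) &
    forall j, lt j i -> forall s, s <= r -> ~ phi (f j) s.
  have [i] : exists i, exists2 s, s <= r & phi (f i) s by exists r, r.
  elim/(well_founded_ind lt_wf): i => i IH hi.
  have [[j ji hj]|nj] := pselect
    (exists2 j, lt j i & exists2 s, s <= r & phi (f j) s).
    exact: IH hj.
  by exists i => // j ji s sr hj; apply: nj; exists j => //; exists s.
exists s; first exact: le_trans rq.
apply: phi_eq (hi); apply: feq_sym; apply: mE; split=> // j ji t ts.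
exact/(imin _ ji)/(le_trans ts).
Qed.

(** * Members of check names, and ordinals *)

Lemma check_elim (I : Type) (f : I -> V) a psi p : regular psi ->
  fmem a (check (Vset f)) p ->
  (forall r i, r <= p -> feq a (check (f i)) r -> psi r) -> psi p.
Proof. exact: fam_elim. Qed.

Lemma check_in (I : Type) (f : I -> V) i p :
  fmem (check (f i)) (check (Vset f)) p.
Proof. exact: (fam_in (fun i => check (f i))). Qed.

Lemma Vmem_elim (v : V) a psi p : regular psi -> fmem a (check v) p ->
  (forall r w, r <= p -> Vmem w v -> feq a (check w) r -> psi r) -> psi p.
Proof.
case: v => I f R h k; apply: (check_elim R h) => r i rp e.
by apply: (k r (f i)) => //; exists i; apply: Veq_refl.
Qed.

Lemma f_ordinal_eq a b p : feq a b p -> f_ordinal a p -> f_ordinal b p.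
Proof.
move=> ab [h1 h2]; split=> [x q qp xb y r rq yx|x q qp xb].
  apply: fmem_eqr (feq_mono (le_trans rq qp) ab) _; apply: (h1 x q qp _ y r rq yx).
  by apply: (fmem_eqr _ xb); apply: feq_sym; apply: feq_mono ab.
by apply: (h2 x q qp); apply: (fmem_eqr _ xb); apply: feq_sym; apply: feq_mono ab.
Qed.

Lemma f_ordinal_check (v : V) p : Vordinal v -> f_ordinal (check v) p.
Proof.
move=> [h1 h2]; split=> [x q qp xv y r rq yx|x q qp xv y r rq yx z s sr zy].
  apply: (Vmem_elim _ (fmem_mono rq xv)) => s w sr wv xw.
  apply: (Vmem_elim _ (fmem_eqr xw (fmem_mono sr yx))) => t u ts uw yu.
  by apply: fmem_eql (feq_sym yu) _; apply: mem_check; apply: h1 uw.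
apply: (Vmem_elim _ (fmem_mono (le_trans sr rq) xv)) => t w ts wv xw.
apply: fmem_eqr (feq_sym xw) _.
have yw := fmem_eqr xw (fmem_mono (le_trans ts sr) yx).
apply: (Vmem_elim _ yw) => t' u t't uw yu.
have zu := fmem_eqr yu (fmem_mono (le_trans t't ts) zy).
apply: (Vmem_elim _ zu) => {zu} t2 u' t2t u'u zu.
by apply: fmem_eql (feq_sym zu) _; apply: mem_check; apply: h2 u'u.
Qed.

(** * Functions with domain in the ground model *)

(** Runs and positions in the extension take this form: the innings are ground-model ordinals, the
    moves arbitrary names. *)
Definition fun_name (I : Type) (g : I -> V) (H : I -> name P) : name P :=
  fam (fun i => pair_name (check (g i)) (H i)).

Section FunName.
Context (I : Type) (g : I -> V) (H : I -> name P).
Hypothesis g_inj : forall i j, Veq (g i) (g j) -> i = j.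

Lemma fun_nameP i h p :
  fmem (pair_name (check (g i)) h) (fun_name g H) p <-> feq h (H i) p.
Proof.
split=> [m|e].
  apply: (fam_elim _ m) => r j rp /pair_inj[/check_eq/g_inj<-//].
apply: (@fmem_eql _ _ (pair_name (check (g i)) (H i))); last exact: fam_in.
by apply: pair_cong; [apply: feq_refl|apply: feq_sym].
Qed.

Lemma fun_name_function T p :
  (forall i, fmem (H i) T p) -> f_function (fun_name g H) (check (Vset g)) T p.
Proof.
move=> HT; split; last split.
- move=> z q qp zf; apply: (fam_elim _ zf) => r i rq e.
  apply: (@fex_intro _ (check (g i))) => s sr; split; first exact: check_in.
  apply: (@fex_intro _ (H i)) => t ts; have tr := le_trans ts sr.
  split; first by apply: fmem_mono (HT i); apply: le_trans (le_trans rq qp).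
  by apply/is_pairP; apply: feq_mono e.
- move=> x q qp xg; apply: (check_elim _ xg) => r i rq e.
  apply: (@fex_intro _ (H i)) => s sr; apply/mapsP.
  apply: (@fmem_eql _ _ (pair_name (check (g i)) (H i))); last exact: fam_in.
  by apply: pair_cong; [apply: feq_sym; apply: feq_mono e|apply: feq_refl].
- move=> x y z q qp [/mapsP hy /mapsP hz].
  apply: (fam_elim _ hy) => r i rq /pair_inj[xi yi].
  have xzi : feq (pair_name x z) (pair_name (check (g i)) z) r.
    by apply: pair_cong => //; apply: feq_refl.
  move: (fmem_eql xzi (fmem_mono rq hz)) => /fun_nameP zi.
  exact: feq_trans yi (feq_sym zi).
Qed.

Lemma fun_name_restriction (D : I -> Prop) s b p :
  feq b (check (Vset (fun i : {i | D i} => g (sval i)))) p ->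
  f_is_restriction s (fun_name g H) b p ->
  feq s (fun_name (fun i : {i | D i} => g (sval i)) (fun i => H (sval i))) p.
Proof.
move=> bD sH; apply/feq_ext => z r rp; have [h1 h2] := sH z; split=> h.
  have [zf zb] := h1 r rp h; apply: (fam_elim _ zf) => q i qr zi.
  apply: (fex_elim _ (forces_mono qr zb)) => t x tq [xb xz].
  apply: (fex_elim _ xz) => u y ut /is_pairP zxy.
  have uq := le_trans ut tq; have up := le_trans uq (le_trans qr rp).
  have [xi yi] := pair_inj (feq_trans (feq_sym zxy) (feq_mono uq zi)).
  have xD := fmem_eqr (feq_mono up bD) (fmem_mono ut xb).
  apply: (check_elim _ xD) => v j vu xj.
  (* The first coordinate of [z] is both [g i] and [g (sval j)], so injectivity places [i] in
     [D]. *)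
  have ij := g_inj (check_eq (feq_trans (feq_sym (feq_mono vu xi)) xj)).
  subst i; apply: fmem_eql (feq_sym (feq_mono (le_trans vu uq) zi)) _.
  exact: (fam_in _ j).
apply: h2 => //; apply: (fam_elim _ h) => q i qr zi; split.
  by apply: fmem_eql (feq_sym zi) _; apply: (fam_in _ (sval i)).
apply: (@fex_intro _ (check (g (sval i)))) => t tq; split.
  have tp := le_trans tq (le_trans qr rp).
  apply: fmem_eqr (feq_sym (feq_mono tp bD)) _.
  exact: (check_in (fun i : {i | D i} => g (sval i))).
apply: (@fex_intro _ (H (sval i))) => u ut; apply/is_pairP.
by apply: feq_mono zi; apply: le_trans tq.
Qed.

End FunName.

(** [U] is forced to be a union of ground-model open sets; a stronger condition decides one of them
    that contains [x]. *)
Lemma generated_topology_base (X : topologicalType) (e : X -> V)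
    (T U : name P) (x : X) p :
  (forall x y : X, Veq (e x) (e y) -> x = y) ->
  forced (f_generated_topology T (check (Vtopology e))) ->
  fmem U T p -> fmem (check (e x)) U p ->
  exists2 r, r <= p & exists W : set X,
    [/\ open W, W x & forall y : X, W y -> fmem (check (e y)) U r].
Proof.
move=> e_inj hT UT xU.
have [h _] := hT p U; have [q qp [F [FB UF]]] := h p (lexx _) UT p (lexx _).
have [h1 _] := UF (check (e x)).
have [r rq [W [WF xW]]] := h1 q (lexx _) (fmem_mono qp xU) q (lexx _).
have WB := FB W r rq WF; have [[[O oO] i] [s [sr _ W_O]]] := WB r (lexx _).
have {i W_O}WO : feq W (check (Vset (fun x : {x | O x} => e (sval x)))) s := W_O.
exists s; first exact: le_trans sr (le_trans rq qp).
exists O; split=> //.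
  have /check_mem[[y Oy] /e_inj->//] := fmem_eqr WO (fmem_mono sr xW).
move=> y Oy; have [_ h2] := UF (check (e y)); apply: h2; first exact: le_trans rq.
apply: (@fex_intro _ W) => t ts; split.
  by apply: fmem_mono WF; apply: le_trans sr.
apply: fmem_eqr (feq_sym (feq_mono ts WO)) _.
by apply: mem_check; exists (exist _ y Oy); apply: Veq_refl.
Qed.

End Forcing.

(** * Recursion along the innings *)

Section WellFoundedRecursion.
Context {d : Order.disp_t} {A : orderType d} (T : Type) (t0 : T).
Hypothesis A_wf : well_founded (fun a b : A => a < b).

(** Filling the future with [t0] lets recursion steps take plain functions on [A] as histories. *)
Definition extend_below (b : A) (f : {c : A | c < b} -> T) (c : A) : T :=
  if pselect (c < b) is left cb then f (exist _ c cb) else t0.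

Lemma extend_belowE b f c (cb : c < b) : extend_below f c = f (exist _ c cb).
Proof.
rewrite /extend_below; case: pselect => // cb'.
by congr (f (exist _ c _)); apply: bool_irrelevance.
Qed.

Definition wfrec (F : A -> (A -> T) -> T) : A -> T :=
  Fix A_wf (fun=> T)
    (fun b rec => F b (extend_below (fun c => rec (sval c) (svalP c)))).

Lemma wfrecE F b :
  wfrec F b = F b (extend_below (fun c : {c | c < b} => wfrec F (sval c))).
Proof.
rewrite {1}/wfrec Fix_eq// => a f g fg; congr (F a (extend_below _)).
by apply: funext => c; apply: fg.
Qed.

(** With a sequence of moves or points as a parameter of [F], this shows that inning [b] does not
    look ahead. *)
Lemma eq_wfrec F G b : (forall c, c <= b -> F c = G c) -> wfrec F b = wfrec G b.
Proof.
elim/(well_founded_ind A_wf): b => b IH FG; rewrite !wfrecE FG//.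
congr (G b (extend_below _)); apply: funext => -[c cb] /=.
by apply: IH => // a ac; apply/FG/(le_trans ac)/ltW.
Qed.

End WellFoundedRecursion.

(** * Von Neumann ordinals for innings and as codes *)

Section VonNeumannRanks.
Context {d : Order.disp_t} {A : orderType d}.
Hypothesis A_wf : well_founded (fun a b : A => a < b).

Lemma VrankE a : Vrank A_wf a = Vset (fun b : {b | b < a} => Vrank A_wf (sval b)).
Proof.
rewrite {1}/Vrank Fix_eq// => b f g fg.
by congr Vset; apply: funext => c; apply: fg.
Qed.

Lemma Vrank_inj a b : Veq (Vrank A_wf a) (Vrank A_wf b) -> a = b.
Proof.
apply: (rank_inj VrankE) => {}a {}b.
by case: (ltgtP a b) => ab; [constructor 1|constructor 3|constructor 2].
Qed.

End VonNeumannRanks.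

(** The cut-and-choose game only admits names of ordinals, so open sets enter it through their ranks
    in a well-order. *)
Lemma ordinal_codes (T : Type) : exists code : T -> V,
  (forall t, Vordinal (code t)) /\ forall s t, Veq (code s) (code t) -> s = t.
Proof.
have [R [R_wf R_trans R_total]] := wellfounded_total_order T.
pose code := Fix R_wf (fun=> V)
  (fun a rec => Vset (fun b : {b | R b a} => rec (sval b) (svalP b))).
have codeE a : code a = Vset (fun b : {b | R b a} => code (sval b)).
  rewrite {1}/code Fix_eq// => b f g fg.
  by congr Vset; apply: funext => c; apply: fg.
exists code; split; first exact: rank_ordinal codeE R_trans.
exact: rank_inj codeE R_total.
Qed.

(** * Replying to ONE's strategy in the extension *)

Section Reply.
Context {disp : Order.disp_t} {P : porderType disp}.
Implicit Types (p q r : P) (s S U : name P).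

Definition check_ordinal v (v_ord : Vordinal v) : ordinal_name P :=
  exist (fun eta => forced (f_ordinal eta)) (check v)
    (fun q => f_ordinal_check q v_ord).

Lemma f_open_cover_eq X T U U' p :
  feq U U' p -> f_open_cover X T U p -> f_open_cover X T U' p.
Proof.
move=> UU [UT XU]; split=> [H q qp HU|x q qp xX].
  by apply: UT => //; apply: fmem_eqr (feq_sym (feq_mono qp UU)) HU.
apply: (fex_elim _ (XU x q qp xX)) => r H rq [HU xH].
apply: (@fex_intro _ _ _ H) => t tr; split; last exact: fmem_mono xH.
apply: fmem_mono (tr) (fmem_eqr (feq_mono _ UU) HU); exact: le_trans qp.
Qed.

Lemma strategy_functional X T alpha S s U U' p : f_ONE_strategy X T alpha S p ->
  fmem (pair_name s U) S p -> fmem (pair_name s U') S p -> feq U U' p.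
Proof.
by move=> [_ [_ h]] sU sU'; apply: (h s U U' p (lexx _)); split; apply/mapsP.
Qed.

Context {X : topologicalType} (e : X -> V).
Hypothesis e_inj : forall x y, Veq (e x) (e y) -> x = y.
Context (code : set X -> V) (code_ord : forall W, Vordinal (code W)).
Context (T alpha S : name P) (p : P).
Hypothesis T_gen : forced (f_generated_topology T (check (Vtopology e))).
Hypothesis S_strategy : f_ONE_strategy (check (Vspace e)) T alpha S p.

(** The maximal principle is used three times: for the cover [U] played by [S], for a member [h] of
    it containing [x], and for the code [eta]. The premise on [s] stands inside the existentials so
    that choice yields a total reply function. *)
Lemma strategy_reply s (x : X) : exists h (eta : ordinal_name P),
  f_position T alpha s p ->
  [/\ exists2 U, fmem (pair_name s U) S p & fmem h U p,
      fmem h T p &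
      forall q, q <= p -> exists2 r, r <= q & exists W : set X,
        [/\ open W, W x, feq (sval eta) (check (code W)) r &
            forall y, W y -> fmem (check (e y)) h r]].
Proof.
have [pos|npos] := pselect (f_position T alpha s p); last first.
  by exists s, (check_ordinal (code_ord set0)) => /npos.
have [S_cover [S_total _]] := S_strategy.
have [U /(_ p (S_total s p (lexx _) pos))/mapsP SU] :
    exists U, forall q, fex (f_maps S s) q -> f_maps S s U q.
  apply: fex_witness => U U' q UU /mapsP sU.
  apply/mapsP; apply: fmem_eql sU; apply: pair_cong UU; exact: feq_refl.
have [UT XU] : f_open_cover (check (Vspace e)) T U p.
  apply: (fex_elim _ (S_cover _ p (lexx _) SU)) => r s' rp h.
  apply: (fex_elim _ h) => {h} t U' tr [/is_pairP/pair_inj[_ UU] [_ cov]].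
  exact: f_open_cover_eq (feq_sym UU) cov.
have [h hP] : exists h, forall q,
    fex (fun h => fand (fmem h U) (fmem (check (e x)) h)) q ->
    fmem h U q /\ fmem (check (e x)) h q.
  apply: fex_witness => h h' q hh [hU xh]; split.
    exact: fmem_eql hh hU.
  exact: fmem_eqr hh xh.
have [hU xh] := hP p (XU _ p (lexx _) (@check_in _ _ _ e x p)).
have hT := UT h p (lexx _) hU.
(* An [ordinal_name] must be an ordinal for all conditions, not only below [p]:
   away from [p] the clause on [W] is void. *)
pose phi (eta : name P) : sentence P := fun q => f_ordinal eta q /\
  forall r, r <= q -> r <= p -> exists2 t, t <= r & exists W : set X,
    [/\ open W, W x, feq eta (check (code W)) t &
        forall y, W y -> fmem (check (e y)) h t].
have [eta etaP] : exists eta, forall q, fex phi q -> phi eta q.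
  apply: fex_witness => [eta|eta eta' q ee [eta_ord etaW]]; first split.
  - move=> q r rq [eta_ord etaW]; split; first exact: forces_mono eta_ord.
    by move=> t tr; apply: etaW; apply: le_trans rq.
  - move=> q etaq; split.
      by apply: forces_dense => r /etaq[t tr []]; exists t.
    move=> r rq rp; have [t tr [_ etaW]] := etaq r rq.
    have [u ut uW] := etaW t (lexx _) (le_trans tr rp).
    by exists u => //; apply: le_trans tr.
  - split; first exact: f_ordinal_eq ee eta_ord.
    move=> r rq rp; have [t tr [W [oW Wx eW Wh]]] := etaW r rq rp.
    exists t => //; exists W; split=> //.
    apply: feq_trans eW; apply: feq_sym; apply: feq_mono ee; exact: le_trans rq.
have phi_eta q : phi eta q.
  (* If [r] is compatible with [p], a suitable [W] is found below both; otherwise [code set0] is a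
     dummy ordinal. *)
  apply: etaP => r rq; have [[t tr tp]|nt] := pselect (exists2 t, t <= r & t <= p).
    have [u ut [W [oW Wx Wh]]] := generated_topology_base e_inj T_gen
      (fmem_mono tp hT) (fmem_mono tp xh).
    exists u; first exact: le_trans tr.
    exists (check (code W)); split; first exact: f_ordinal_check.
    move=> v vu vp; exists v => //; exists W; split=> //; first exact: feq_refl.
    by move=> y /Wh; apply: fmem_mono.
  exists r => //; exists (check (code set0)); split; first exact: f_ordinal_check.
  by move=> t tr tp; case: nt; exists t.
pose eta_ord : ordinal_name P :=
  exist (fun eta => forced (f_ordinal eta)) eta (fun q => (phi_eta q).1).
exists h, eta_ord => _; split=> //; first by exists U.
by move=> q qp; apply: (phi_eta p).2.
Qed.

End Reply.

(** * Pulling ONE's strategy back to the ground model *)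

Section GroundStrategy.
Context {X : topologicalType} (e : X -> V).
Hypothesis e_inj : forall x y, Veq (e x) (e y) -> x = y.
Context {dP : Order.disp_t} {P : porderType dP}.
Context {dA : Order.disp_t} {A : orderType dA}.
Hypothesis A_wf : well_founded (fun a b : A => a < b).
Context (K : cardinal) (K_p : is_p X K) (T : name P).
Hypothesis T_gen : forced (f_generated_topology T (check (Vtopology e))).
Local Notation alpha := (check (Votype A_wf)).

Definition choices_below (H : A -> name P) (b : A) : name P :=
  fun_name (fun c : {c | c < b} => Vrank A_wf (sval c)) (fun c => H (sval c)).

Definition choices (H : A -> name P) : name P := fun_name (Vrank A_wf) H.

Lemma Vrank_sub_inj b (c c' : {c | c < b}) :
  Veq (Vrank A_wf (sval c)) (Vrank A_wf (sval c')) -> c = c'.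
Proof.
case: c c' => c cb [c' c'b] /Vrank_inj /= cc'; subst c'.
by congr (exist _ c _); apply: bool_irrelevance.
Qed.

Lemma choices_below_position H b p : (forall c, c < b -> fmem (H c) T p) ->
  f_position T alpha (choices_below H b) p.
Proof.
move=> HT; apply: (@fex_intro _ _ _ (check (Vrank A_wf b))) => q qp.
split; first exact: check_in.
rewrite VrankE; apply: fun_name_function => [|[c cb]]; first exact: Vrank_sub_inj.
exact: fmem_mono qp (HT c cb).
Qed.

(** Stronger conditions identify an arbitrary inning with some rank [b] and the restriction with
    [choices_below H b]; functionality of [S] then identifies the covers. *)
Lemma choices_run Q S H p : f_ONE_strategy Q T alpha S p ->
  (forall b, fmem (H b) T p) ->
  (forall b, exists2 U,
     fmem (pair_name (choices_below H b) U) S p & fmem (H b) U p) ->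
  f_run T alpha S (choices H) p.
Proof.
move=> S_strategy HT HU; split.
  by apply: fun_name_function => //; apply: Vrank_inj.
move=> beta q qp beta_alpha s U h r rq [s_restr [/mapsP sU /mapsP beta_h]].
apply: (check_elim _ (forces_mono rq beta_alpha)) => t b tr beta_b.
have tp := le_trans tr (le_trans rq qp).
have [U' SU' HU'] := HU b.
have sb : feq s (choices_below H b) t.
  apply: fun_name_restriction (forces_mono tr s_restr); first exact: Vrank_inj.
  by rewrite -VrankE.
have hb : feq h (H b) t.
  rewrite -(fun_nameP H (@Vrank_inj _ _ A_wf) b).
  apply: fmem_eql (fmem_mono tr beta_h).
  by apply: pair_cong => //; apply: feq_refl.
have UU' : feq U U' t.
  apply: (strategy_functional (forces_mono tp S_strategy) (s := choices_below H b)).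
    apply: fmem_eql (fmem_mono tr sU).
    by apply: pair_cong => //; apply: feq_refl.
  exact: fmem_mono tp SU'.
apply: fmem_eql (feq_sym hb) (fmem_eqr (feq_sym UU') (fmem_mono tp HU')).
Qed.

Lemma choices_TWO_wins H c p :
  (forall x : X, exists2 b, b < c & fmem (check (e x)) (H b) p) ->
  f_TWO_wins_run (check (Vspace e)) alpha (choices H) p.
Proof.
move=> Hc; apply: (@fex_intro _ _ _ (check (Vrank A_wf c))) => q qp.
split=> [|y r rq yX]; first exact: check_in.
apply: (check_elim _ yX) => t x tr yx; have [b bc xb] := Hc x.
apply: (@fex_intro _ _ _ (check (Vrank A_wf b))) => u ut; split.
  rewrite (VrankE A_wf c).
  exact: (check_in (fun a : {a | a < c} => Vrank A_wf (sval a)) (exist _ b bc)).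
apply: (@fex_intro _ _ _ (H b)) => v vu; have vt := le_trans vu ut.
split; first by apply/mapsP; exact: (fam_in _ b).
apply: fmem_eql (feq_sym (feq_mono vt yx)) (fmem_mono _ xb).
exact: le_trans vt (le_trans tr (le_trans rq qp)).
Qed.

Lemma ONE_strategy_pullback S p :
  TWO_has_winning_strategy_CG A P K ->
  f_ONE_strategy (check (Vspace e)) T alpha S p ->
  (forall H, f_run T alpha S H p ->
     fnot (f_TWO_wins_run (check (Vspace e)) alpha H) p) ->
  ONE_has_winning_strategy_G1 A X.
Proof.
move=> [CG [CG_moves CG_wins]] S_strategy S_wins.
(* The recursion below needs a default point. If [X] is empty, the empty family is an open cover
   from which TWO cannot choose. *)
have [[x0 _]|X0] := pselect (exists x : X, True); last first.
  exists (fun b h => set0); split=> [b h _|H H_run [c _]]; last exact: H_run c.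
  by split=> //; apply/seteqP; split=> // x; case: X0; exists x.
have [code [code_ord code_inj]] := ordinal_codes (set X).
have /choice[reply replyP] (sx : name P * X) :
    exists he : name P * ordinal_name P, f_position T alpha sx.1 p ->
    [/\ exists2 U, fmem (pair_name sx.1 U) S p & fmem he.1 U p,
      fmem he.1 T p &
      forall q, q <= p -> exists2 r, r <= q & exists W : set X,
        [/\ open W, W sx.2, feq (sval he.2) (check (code W)) r &
            forall y, W y -> fmem (check (e y)) he.1 r]].
  have [h [eta heP]] := strategy_reply e_inj code_ord T_gen S_strategy sx.1 sx.2.
  by exists (h, eta).
(* [H xs] is the run against [S] guided by the points [xs]; each position consists of the earlier
   replies. *)
pose H xs := wfrec S A_wf (fun b H => (reply (choices_below H b, xs b)).1).
pose eta xs b := (reply (choices_below (H xs) b, xs b)).2.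
have HE xs b : H xs b = (reply (choices_below (H xs) b, xs b)).1.
  rewrite {1}/H wfrecE; congr (reply (fun_name _ _, _)).1.
  by apply: funext => -[c cb] /=; rewrite extend_belowE.
have H_eq xs ys b : (forall c, c <= b -> xs c = ys c) -> H xs b = H ys b.
  by move=> xy; apply: eq_wfrec => c cb; rewrite xy.
have eta_eq xs ys b : (forall c, c <= b -> xs c = ys c) -> eta xs b = eta ys b.
  move=> xy; rewrite /eta xy//; congr (reply (fun_name _ _, _)).2.
  apply: funext => -[c cb] /=; apply: H_eq => a ac; apply: xy.
  exact: le_trans (ltW cb).
pose C xs b := CG p b (fun c => eta xs (sval c)).
pose nbhds xs b := [set W | [/\ open W, W (xs b) & Vmem (code W) (C xs b)]].
pose B xs b := \bigcap_(W in nbhds xs b) W.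
have B_eq xs ys b : (forall c, c <= b -> xs c = ys c) -> B xs b = B ys b.
  move=> xy; rewrite /B /nbhds /C xy//; congr (bigcap _ _).
  suff -> : (fun c : {c | c <= b} => eta xs (sval c)) =
            (fun c => eta ys (sval c)) by [].
  apply: funext => -[c cb] /=; apply: eta_eq => a ac; apply: xy; exact: le_trans cb.
have B_open xs b : open (B xs b).
  have [_ CK] := CG_moves p b (fun c => eta xs (sval c)).
  apply: (@small_family_bigcap_open X K _ code _ K_p CK).
  - by move=> W [].
  - by move=> U W _ _ /code_inj.
  - by move=> W [].
(* [upd] tries the point [x] in inning [b]; by [B_eq] the entries after [b] do not affect [B] at
   [b]. *)
pose upd (xs : A -> X) b x c := if c == b then x else xs c.
(* TWO's moves determine only the sets [B x], so the points are chosen anew. *)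
pose pts (D : A -> set X) :=
  wfrec x0 A_wf (fun b xs => xget x0 [set x | D b = B (upd xs b x) b]).
have pts_eq D D' b : (forall c, c <= b -> D c = D' c) -> pts D b = pts D' b.
  by move=> DD'; apply: eq_wfrec => c cb; rewrite DD'.
have upd_eq xs ys b x c : (forall a, a < b -> xs a = ys a) -> c <= b ->
    upd xs b x c = upd ys b x c.
  rewrite /upd => xy cb; case: eqVneq => // cb'; apply: xy.
  by rewrite lt_neqAle cb'.
(* The filler [set0] has no effect: [upd] overwrites the point at [b], and earlier points depend on
   earlier moves only. *)
exists (fun b h => range (fun x => B (upd (pts (extend_below set0 h)) b x) b)).
split=> [b h _|D D_run [c Dc]].
  split=> [_ [x _ <-]//|]; apply/seteqP; split=> // x _.
  exists (B (upd (pts (extend_below set0 h)) b x) b); first by exists x.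
  by move=> W [_ + _]; rewrite /upd eqxx.
pose xs := pts D.
have D_xs b : D b = B xs b.
  have : exists x, D b = B (upd xs b x) b.
    have [x _ Dx] := D_run b; exists x; rewrite -Dx; apply: B_eq => a ab.
    apply: upd_eq ab => a' a'b; apply: pts_eq => a2 a2a'.
    by rewrite extend_belowE//; apply: le_lt_trans a'b.
  have : xs b = xget x0 [set x | D b = B (upd xs b x) b].
    rewrite {1}/xs /pts wfrecE; congr (xget x0 _); apply/seteqP.
    by split=> x /= ->; apply: B_eq => a; apply: upd_eq => a' a'b;
      rewrite extend_belowE.
  move=> xsE /(@xgetPex _ x0 [set x | D b = B (upd xs b x) b]); rewrite -xsE => ->.
  by apply: B_eq => a ab; rewrite /upd; case: eqVneq => // ->.
(* The inning [c] by which the ground-model run covers [X] bounds the names that the single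
   condition [q] must handle. *)
have [q qp q_wins] := CG_wins p (eta xs) c.
have H_reply b : f_position T alpha (choices_below (H xs) b) p.
  elim/(well_founded_ind A_wf): b => b IH.
  apply: choices_below_position => a ab; rewrite HE.
  by have [] := replyP (_, xs a) (IH a ab).
have H_T b : fmem (H xs b) T p.
  by rewrite HE; have [] := replyP (_, xs b) (H_reply b).
have H_run : f_run T alpha S (choices (H xs)) p.
  apply: choices_run S_strategy H_T _ => b; rewrite HE.
  by have [] := replyP (_, xs b) (H_reply b).
apply: (S_wins _ H_run q qp); apply: (@choices_TWO_wins _ c) => x.
have [b /= bc Dbx] : (\bigcup_(b in [set b | (b < c)%O]) D b) x by rewrite Dc.
(* The open set coded by [eta xs b] is decided only densely below [q]. *)
exists b => //; apply: forces_dense => r rq.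
have [_ _ etaP] := replyP (_, xs b) (H_reply b).
have [s sr [W [oW Wx etaW WH]]] := etaP r (le_trans rq qp).
exists s => //; rewrite HE; apply: WH.
(* [W] is among the sets intersected in [B xs b]: [s] forces its code into [C xs b], and membership
   between check names is absolute. *)
move: Dbx; rewrite D_xs; apply; split=> //.
apply: (@check_mem _ P _ _ s); apply: fmem_eql etaW _.
exact: fmem_mono (le_trans sr rq) (q_wins b bc).
Qed.

End GroundStrategy.

Theorem theorem4p2 (X : topologicalType)
  (e : X -> V) (e_inj : forall x y, Veq (e x) (e y) -> x = y)
  (dP : Order.disp_t) (P : porderType dP)
  (dA : Order.disp_t) (A : orderType dA)
  (A_wf : well_founded (fun a b : A => (a < b)%O))
  (K : cardinal) (K_p : is_p X K) :
  ~ ONE_has_winning_strategy_G1 A X ->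
  TWO_has_winning_strategy_CG A P K ->
  forall tauP : name P,
    forced (f_generated_topology tauP (check (Vtopology e))) ->
    forced (fnot (f_ONE_has_winning_strategy_G1
                    (check (Vspace e)) tauP (check (Votype A_wf)))).
Proof.
(* A condition [q] forcing that ONE has a winning strategy extends to some [r] with a name [S] for
   one, which is pulled back at [r]. *)
move=> no_ONE TWO T T_gen p q qp /(_ q (lexx _))[r rq [S [S_strategy S_wins]]].
apply: no_ONE.
apply: (ONE_strategy_pullback e_inj K_p T_gen TWO S_strategy) => H H_run.
exact: S_wins H_run.
Qed.
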